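(* Let $\mathcal{C}=\bigcup_{n\ge 1}\mathcal{C}(\mathbb{T}^n)$ be a Boyd--Lawton collection of functions, let $n\ge 1$, and let $g\in\mathcal{C}(\mathbb{T}^n)$. Let $(q_{A_i})_i$ be a sequence of continuous homomorphisms $q_{A_i}\colon\mathbb{T}^{m_i}\to\mathbb{T}^n$, with each $m_i$ a positive integer, such that the sequence of Boyd heights $(\mu(q_{A_i}))_i$ approaches $\infty$. Then $$\int_{\mathbb{T}^n} g\,d\tau_n=\lim_{i\to\infty}\int_{\mathbb{T}^{m_i}} g\circ q_{A_i}\,d\tau_{m_i}.$$
   Context: $\mathbb{T}$ is the unit circle in $\mathbb{C}$; $\mathbb{T}^n=\{(z_1,\dots,z_n)\in\mathbb{C}^n: |z_1|=\dots=|z_n|=1\}$ is a compact group under coordinatewise multiplication, with normalized Haar measure $\tau_n$ (total mass 1); $\tau=\tau_1$. For an $n\times m$ integer matrix $A=(a_{ij})$, $q_A\colon\mathbb{T}^m\to\mathbb{T}^n$ is the continuous homomorphism $q_A(z_1,\dots,z_m)=(z_1^{a_{11}}z_2^{a_{12}}\cdots z_m^{a_{1m}},\dots,z_1^{a_{n1}}z_2^{a_{n2}}\cdots z_m^{a_{nm}})$. Every continuous homomorphism $\mathbb{T}^m\to\mathbb{T}^n$ is $q_A$ for a unique such $A$. A vector $\mathbf{r}\in\mathbb{Z}^n$ is viewed as an $n\times1$ matrix, so $q_{\mathbf{r}}\colon\mathbb{T}\to\mathbb{T}^n$, $q_{\mathbf r}(z)=(z^{r_1},\dots,z^{r_n})$.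 The Boyd height is $\mu(q_A)=\mu(A)=\min\{\|\mathbf{v}\|_\infty:\mathbf{v}\in\mathbb{Z}^n,\ \mathbf{v}\ne\mathbf{0},\ \mathbf{v}\cdot A=\mathbf{0}\}$ ($\mathbf v$ a row vector, $\|\mathbf v\|_\infty$ the largest absolute value of a coordinate), and $\mu(q_A)=\infty$ if no such $\mathbf{v}$ exists. The heights in the sequence may be infinite; approaching $\infty$ means that for every real $M$ all but finitely many terms are $\ge M$. A Boyd--Lawton collection $\mathcal{C}=\bigcup_{n\ge1}\mathcal{C}(\mathbb{T}^n)$ is a collection of functions such that: (1) If $g\in\mathcal{C}(\mathbb{T}^n)$ then $g$ is defined and complex-valued almost everywhere on $\mathbb{T}^n$ and is integrable (it gives an element of $L^1(\mathbb{T}^n)$). (2) For each $g\in\mathcal{C}(\mathbb{T}^n)$ with $n\ge2$, $\int_{\mathbb{T}^n}g\,d\tau_n=\lim_{\mu(q_{\mathbf r})\to\infty}\int_{\mathbb{T}}g\circ q_{\mathbf r}\,d\tau$, where $q_{\mathbf r}\colon\mathbb{T}\to\mathbb{T}^n$ varies over the homomorphisms given by $\mathbf r\in\mathbb{Z}^n$ (implicit: for all large enough $\mu(q_{\mathbf r})$ the function $g\circ q_{\mathbf r}$ is integrable). The limit means: for every $\varepsilon>0$ there is $M$ such that the two integrals differ by less than $\varepsilon$ whenever $\mu(q_{\mathbf r})\ge M$. (3) If $g\in\mathcal{C}(\mathbb{T}^n)$, there is a bound $B$ such that for every $m\ge1$ and every $q_A\colon\mathbb{T}^m\to\mathbb{T}^n$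 with $\mu(q_A)\ge B$, the composition $g\circ q_A$ is in $\mathcal{C}(\mathbb{T}^m)$. Functions are actual (partially defined) functions, not almost-everywhere classes; $g\circ q_A$ is defined at the points that $q_A$ maps into the domain of $g$. *)

(* Defs.v *)
From HB Require Import structures.
From mathcomp Require Import all_boot all_order all_algebra.
From mathcomp Require Import all_classical all_reals all_analysis.
From mathcomp Require Import complex.

Set Implicit Arguments.
Unset Strict Implicit.
Unset Printing Implicit Defensive.

Import Order.TTheory GRing.Theory Num.Theory.
Import numFieldNormedType.Exports.

Local Open Scope classical_set_scope.
Local Open Scope ring_scope.
Local Open Scope complex_scope.

Definition torus (R : realType) (n : nat) : Type :=
  {z : 'rV[R[i]]_n | [forall j, `|z ord0 j| == 1]}.

HB.instance Definition _ (R : realType) (n : nat) := Choice.on (torus R n).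

Lemma torus_one_subproof (R : realType) (n : nat) :
  [forall j, `|(const_mx 1 : 'rV[R[i]]_n) ord0 j| == 1].
Proof. by apply/forallP => j; rewrite mxE normr1. Qed.

Definition torus_one (R : realType) (n : nat) : torus R n :=
  exist _ (const_mx 1) (torus_one_subproof R n).

HB.instance Definition _ (R : realType) (n : nat) :=
  isPointed.Build (torus R n) (torus_one R n).

Lemma torus_mul_subproof (R : realType) (n : nat) (z w : torus R n) :
  [forall j, `|(\row_k (val z ord0 k * val w ord0 k)) ord0 j| == 1].
Proof.
apply/forallP => j; rewrite mxE normrM.
by rewrite (eqP (forallP (valP z) j)) (eqP (forallP (valP w) j)) mulr1.
Qed.

Definition torus_mul (R : realType) (n : nat) (z w : torus R n) : torus R n :=
  exist _ (\row_k (val z ord0 k * val w ord0 k)) (torus_mul_subproof z w).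

Lemma torus_hom_subproof (R : realType) (n m : nat) (A : 'M[int]_(n, m))
    (z : torus R m) :
  [forall k, `|(\row_i \prod_j (val z ord0 j ^ A i j)) ord0 k| == 1].
Proof.
apply/forallP => k; rewrite mxE normr_prod big1// => j _.
have zj1 : `|val z ord0 j| = 1 by apply/eqP; exact: (forallP (valP z) j).
by case: (A k j) => p; rewrite ?NegzE ?exprN ?normfV normrX zj1 expr1n ?invr1.
Qed.

(* q_A : T^m -> T^n, with i-th coordinate \prod_j z_j ^ a_ij *)
Definition torus_hom (R : realType) (n m : nat) (A : 'M[int]_(n, m))
    (z : torus R m) : torus R n :=
  exist _ (\row_i \prod_j (val z ord0 j ^ A i j)) (torus_hom_subproof A z).

(* T^n with the topology induced by C^n; the regular module R[i]^o only serves
   to equip R[i] with its norm topology. *)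
Definition torus_top (R : realType) (n : nat) : Type :=
  initial_topology (fun z : torus R n => val z : 'rV[R[i]^o]_n).

HB.instance Definition _ (R : realType) (n : nat) :=
  PointedTopological.on (torus_top R n).

Definition torus_borel (R : realType) (n : nat) : Type :=
  g_sigma_algebraType (@open (torus_top R n)).

HB.instance Definition _ (R : realType) (n : nat) :=
  Measurable.on (torus_borel R n).

Definition normalized_haar (R : realType) (n : nat)
    (tau : probability (torus_borel R n) R) : Prop :=
  forall (a : torus R n) (U : set (torus_borel R n)), measurable U ->
    tau (torus_mul a @^-1` U) = tau U.

(* Partially defined complex-valued functions on T^n: the domain of g is
   {z | g z <> None}, so that g \o torus_hom A is defined exactly at the
   points that torus_hom A sends into the domain of g. *)
Definition pfun (R : realType) (n : nat) : Type := torus R n -> option R[i].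

(* h is an integrable everywhere defined Borel function in the L^1 class
   of g. The composition of g with a homomorphism whose image is a null set is
   in general not Borel, so g itself is not required to be so (this amounts to
   measurability with respect to the completed sigma-algebra). *)
Definition L1_rep (R : realType) (n : nat)
    (tau : probability (torus_borel R n) R) (g : pfun R n)
    (h : torus_borel R n -> R[i]) : Prop :=
  [/\ tau.-integrable setT (fun z => (complex.Re (h z))%:E),
      tau.-integrable setT (fun z => (complex.Im (h z))%:E)
    & {ae tau, forall z, g z = Some (h z)}].

Definition in_L1 (R : realType) (n : nat)
    (tau : probability (torus_borel R n) R) (g : pfun R n) : Prop :=
  exists h, L1_rep tau g h.

(* Independent of the chosen h, as two of them agree almost everywhere; the
   value is meaningless unless in_L1 tau g. *)
Definition torus_integral (R : realType) (n : nat)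
    (tau : probability (torus_borel R n) R) (g : pfun R n) : R[i] :=
  let h := xget (fun=> 0) [set h | L1_rep tau g h] in
  (\int[tau]_z complex.Re (h z)) +i* (\int[tau]_z complex.Im (h z)).

Definition sup_norm (n : nat) (v : 'rV[int]_n) : nat :=
  (\max_(j < n) `|v ord0 j|)%N.

(* The infimum of a nonempty set of natural numbers is its minimum, and
   ereal_inf set0 = +oo. *)
Definition boyd_height (R : realType) (n m : nat) (A : 'M[int]_(n, m)) :
    \bar R :=
  ereal_inf [set ((sup_norm v)%:R)%:E |
             v in [set v : 'rV[int]_n | v != 0 /\ v *m A = 0]].

Record boyd_lawton (R : realType)
    (tau : forall n, probability (torus_borel R n) R)
    (C : forall n, set (pfun R n)) : Prop := BoydLawton {
  boyd_lawton_L1 : forall (n : nat) (g : pfun R n), (0 < n)%N ->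
    C n g -> in_L1 (tau n) g;
  boyd_lawton_lim : forall (n : nat) (g : pfun R n), (1 < n)%N ->
    C n g -> forall e : R, 0 < e -> exists M : R, forall r : 'cV[int]_n,
      (M%:E <= boyd_height R r)%E ->
      in_L1 (tau 1) (g \o torus_hom r) /\
      `|torus_integral (tau n) g - torus_integral (tau 1) (g \o torus_hom r)|
        < e%:C;
  boyd_lawton_comp : forall (n : nat) (g : pfun R n), (0 < n)%N ->
    C n g -> exists B : R, forall (m : nat) (A : 'M[int]_(n, m)), (0 < m)%N ->
      (B%:E <= boyd_height R A)%E -> C m (g \o torus_hom A) }.

(* Main.v *)
Require Import Defs.
From HB Require Import structures.
From mathcomp Require Import all_boot all_order all_algebra.
From mathcomp Require Import all_classical all_reals all_analysis.
From mathcomp Require Import complex measurable_realfun lra zify.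

(** The defining limit of a Boyd--Lawton collection runs over columns r, that is
    over homomorphisms from the circle; the theorem extends it to arbitrary
    matrices.

    For n > 1, a homomorphism q_A from T^m of large height is compared with
    homomorphisms from the circle that factor through it. The function g o q_A
    again belongs to the collection, so when m > 1 its integral is approximated
    by the integrals of g o q_A o q_s = g o q_(A s) with s a column of large
    height. Such columns exist ([exists_high_column]), and for fixed A the height
    of A s stays as large as that of A once s is high enough
    ([boyd_height_mulmx]). Thus g o q_(A s) also has an integral close to that of
    g, and the triangle inequality concludes ([boyd_lawton_lim_matrix]).

    For n = 1 there is no limit property for g itself, but height at least 2
    forces the row A to be nonzero, so q_A is onto the circle. An onto
    homomorphism carries Haar measure to Haar measure
    ([torus_hom_preserves_haar], the Fubini proof of uniqueness of Haar measure),
    hence the integrals of g and of g o q_A are equal. The measurability needed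
    for Tonelli's theorem on a product of tori rests on a countable base of
    coordinate boxes ([measurable_to_torus]). *)

Import Order.TTheory GRing.Theory Num.Theory.
Import numFieldNormedType.Exports.

Set Implicit Arguments.
Unset Strict Implicit.
Unset Printing Implicit Defensive.

Local Open Scope classical_set_scope.
Local Open Scope ring_scope.
Local Open Scope complex_scope.

(** * Complex-valued measurable functions *)

Section complex_parts.
Variable R : realType.
Implicit Types z w : R[i].

Lemma normr_complexi : `|'i%C| = 1 :> R[i].
Proof.
rewrite normc_def /= (_ : 0 ^+ 2 + 1 ^+ 2 = 1 :> R) ?sqrtr1//.
by rewrite expr0n expr1n add0r.
Qed.

Lemma normr_Im_le z : `|complex.Im z|%:C <= `|z|.
Proof.
have := normc_ge_Re (z * 'i%C).
by rewrite ReiNIm normrN normrM normr_complexi mulr1.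
Qed.

Lemma normr_real_complex (x : R) : `|x%:C| = `|x|%:C.
Proof.
by rewrite normc_def /= (_ : 0 ^+ 2 = 0 :> R) ?addr0 ?sqrtr_sqr ?expr0n.
Qed.

Lemma normr_le_Re_Im z : `|z| <= (`|complex.Re z| + `|complex.Im z|)%:C.
Proof.
rewrite {1}(complexE z); apply: (le_trans (ler_normD _ _)).
by rewrite normrM normr_complexi mul1r !normr_real_complex -rmorphD.
Qed.

Lemma open_Re_gt (a : R) : open [set z : R[i]^o | a < complex.Re z].
Proof.
rewrite openE => z /= az; apply/nbhs_ballP.
exists (complex.Re z - a)%:C => /=; first by rewrite ltcR subr_gt0.
move=> w; rewrite -ball_normE /= => zw.
have := le_lt_trans (normc_ge_Re _) zw; rewrite ltcR raddfB /=.
by move/(le_lt_trans (ler_norm _)); rewrite ltrD2l ltrN2.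
Qed.

Lemma open_Im_gt (a : R) : open [set z : R[i]^o | a < complex.Im z].
Proof.
rewrite openE => z /= az; apply/nbhs_ballP.
exists (complex.Im z - a)%:C => /=; first by rewrite ltcR subr_gt0.
move=> w; rewrite -ball_normE /= => zw.
have := le_lt_trans (normr_Im_le _) zw; rewrite ltcR raddfB /=.
by move/(le_lt_trans (ler_norm _)); rewrite ltrD2l ltrN2.
Qed.

End complex_parts.

Section complex_measurable.
Variables (R : realType) (d : measure_display) (X : measurableType d).

(** Borel measurability into the plane, expressed through the two real
    coordinates. *)
Definition cmeasurable (f : X -> R[i]) :=
  measurable_fun setT (fun x => complex.Re (f x)) /\
  measurable_fun setT (fun x => complex.Im (f x)).

Lemma cmeasurable_cst (c : R[i]) : cmeasurable (fun=> c).
Proof. by split; exact: measurable_cst. Qed.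

Lemma cmeasurableM f g : cmeasurable f -> cmeasurable g ->
  cmeasurable (fun x => f x * g x).
Proof.
move=> [rf mf] [rg mg]; split.
- rewrite [X in measurable_fun _ X](_ : _ = (fun x =>
      (complex.Re (f x) * complex.Re (g x)
       - complex.Im (f x) * complex.Im (g x)))).
    by apply: measurable_funB; exact: measurable_funM.
  by apply/funext => x; case: (f x) => a b; case: (g x).
- rewrite [X in measurable_fun _ X](_ : _ = (fun x =>
      (complex.Re (f x) * complex.Im (g x)
       + complex.Im (f x) * complex.Re (g x)))).
    by apply: measurable_funD; exact: measurable_funM.
  by apply/funext => x; case: (f x) => a b; case: (g x).
Qed.

(** On the unit circle inversion is conjugation, so only a sign changes. *)
Lemma cmeasurableV f : (forall x, `|f x| = 1) -> cmeasurable f ->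
  cmeasurable (fun x => (f x)^-1).
Proof.
move=> f1 [rf mf]; split.
- rewrite [X in measurable_fun _ X](_ : _ = (fun x => complex.Re (f x)))//.
  apply/funext => x; rewrite invc_norm f1 expr1n invr1 mul1r.
  by case: (f x).
- rewrite [X in measurable_fun _ X](_ : _ = (fun x => - complex.Im (f x))).
    exact: measurable_funN.
  apply/funext => x; rewrite invc_norm f1 expr1n invr1 mul1r.
  by case: (f x).
Qed.

Lemma cmeasurableXz f (a : int) : (forall x, `|f x| = 1) -> cmeasurable f ->
  cmeasurable (fun x => f x ^ a).
Proof.
move=> f1 mf.
have mX k : cmeasurable (fun x => f x ^+ k).
  elim: k => [|k IH]; first exact: cmeasurable_cst.
  by under eq_fun do rewrite exprS; exact: cmeasurableM.
case: a => k; first exact: mX.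
under eq_fun do rewrite NegzE -exprnN.
by apply: cmeasurableV => // x; rewrite normrX f1 expr1n.
Qed.

Lemma cmeasurable_prod (I : Type) (s : seq I) (F : I -> X -> R[i]) :
  (forall i, cmeasurable (F i)) -> cmeasurable (fun x => \prod_(i <- s) F i x).
Proof.
move=> mF; elim: s => [|i s IH].
  by under eq_fun do rewrite big_nil; exact: cmeasurable_cst.
by under eq_fun do rewrite big_cons; exact: cmeasurableM.
Qed.

End complex_measurable.

Lemma cmeasurable_comp (R : realType) d d' (X : measurableType d)
    (Y : measurableType d')
    (f : X -> Y) (h : Y -> R[i]) :
  measurable_fun setT f -> cmeasurable h -> cmeasurable (h \o f).
Proof.
by move=> mf [rh mh]; split; [apply: (measurableT_comp rh)|
  apply: (measurableT_comp mh)].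
Qed.

(** * The Borel sets of the torus *)

Section torus_measurable.
Variables (R : realType) (n : nat).

Lemma torus_coord_norm (z : torus R n) k : `|val z ord0 k| = 1.
Proof. by apply/eqP; exact: (forallP (valP z) k). Qed.

Lemma open_torus_measurable (V : set 'rV[R[i]^o]_n) : open V ->
  measurable ([set z | V (val z)] : set (torus_borel R n)).
Proof. by move=> oV; apply: sub_sigma_algebra; exists V. Qed.

Lemma torus_coord_measurable k :
  cmeasurable (fun z : torus_borel R n => val z ord0 k).
Proof.
have coordo (D : set R[i]^o) : open D ->
    open [set M : 'rV[R[i]^o]_n | D (M ord0 k)].
  by apply: open_comp => M _; exact: coord_continuous.
split=> mT; apply: (measurability _ (RGenOInfty.measurableE R)) => //.
- move=> _ [_ [a ->] <-]; rewrite setTI preimage_itvoy.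
  exact: (open_torus_measurable (coordo _ (@open_Re_gt _ a))).
- move=> _ [_ [a ->] <-]; rewrite setTI preimage_itvoy.
  exact: (open_torus_measurable (coordo _ (@open_Im_gt _ a))).
Qed.

(** The boxes are centred at points with rational real and imaginary parts, so
    that there are countably many of them. *)
Definition rat_box (t : 'rV[rat]_n * 'rV[rat]_n * nat) : set 'rV[R[i]^o]_n :=
  [set M | forall j,
    `|complex.Re (M ord0 j) - ratr (t.1.1 ord0 j)| < t.2.+1%:R^-1 /\
    `|complex.Im (M ord0 j) - ratr (t.1.2 ord0 j)| < t.2.+1%:R^-1].

Lemma rat_box_basis (V : set 'rV[R[i]^o]_n) M : open V -> V M ->
  exists2 t, rat_box t M & rat_box t `<=` V.
Proof.
rewrite openE => /[apply] /nbhs_ballP[e /= e0 eV].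
have [r r0 rV] : exists2 r : R, 0 < r & ball M r%:C `<=` V.
  exists (complex.Re e); first by move: e0; rewrite ltcE => /andP[].
  by rewrite RRe_real ?gtr0_real.
(* Two points of one box of half-width d differ by less than 2d in each of the
   two real coordinates, so the entries differ by less than 4d <= r. *)
have [k] := @ltr_add_invr R 0 (r / 4) ltac:(by rewrite divr_gt0).
rewrite add0r => ke; set d : R := k.+1%:R^-1.
have d0 : 0 < d by rewrite invr_gt0.
have ratapprox (x : R) : exists q : rat, `|x - ratr q| < d.
  have [|q] := @rat_in_itvoo R (x - d) (x + d).
    by rewrite ltrBlDr -addrA ltrDl addr_gt0.
  rewrite in_itv /= => /andP[? ?]; exists q.
  by rewrite ltr_norml; apply/andP; split; lra.
have [a aP] := choice (fun j => ratapprox (complex.Re (M ord0 j))).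
have [b bP] := choice (fun j => ratapprox (complex.Im (M ord0 j))).
exists (\row_j a j, \row_j b j, k) => [j|N MN] /=; first by rewrite !mxE.
apply: rV; split=> [|i j]; first by rewrite ltcR.
rewrite (ord1 i) -ball_normE /=.
apply: (le_lt_trans (normr_le_Re_Im _)); rewrite ltcR !raddfB /=.
have [] := MN j; rewrite /= !mxE.
move: (aP j) (bP j) ke; rewrite -/d.
rewrite !ltr_norml => /andP[? ?] /andP[? ?] ? /andP[? ?] /andP[? ?].
have h (x : R) : - (2 * d) < x -> x < 2 * d -> `|x| < 2 * d.
  by move=> *; rewrite ltr_norml; apply/andP.
apply: (@lt_le_trans _ _ (2 * d + 2 * d)); last lra.
by apply: ltrD; apply: h; lra.
Qed.

(** The topology of the torus has a countable base made of sets cut out by the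
    real coordinates. Hence coordinatewise measurability suffices, on any
    measurable space, in particular on a product of two tori, whose product
    sigma-algebra is not presented as a Borel one. *)
Lemma measurable_to_torus d (X : measurableType d) (f : X -> torus_borel R n) :
  (forall k, cmeasurable (fun x => val (f x) ord0 k)) -> measurable_fun setT f.
Proof.
move=> mf mT.
apply: (measurability (rT := torus_borel R n) (@open (torus_top R n)) erefl)
  => //.
move=> _ [_ [V oV <-] <-]; rewrite setTI.
pose F t := if `[< rat_box t `<=` V >] then [set x | rat_box t (val (f x))]
  else set0.
rewrite (_ : _ @^-1` _ = \bigcup_t F t).
  apply: countable_bigcupT_measurable => // t; rewrite /F; case: ifP => // _.
  rewrite (_ : [set x | _] = \bigcap_(j in [set: 'I_n])
    ([set x | `|complex.Re (val (f x) ord0 j) - ratr (t.1.1 ord0 j)|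
                < t.2.+1%:R^-1]
     `&` [set x | `|complex.Im (val (f x) ord0 j) - ratr (t.1.2 ord0 j)|
                    < t.2.+1%:R^-1])).
    apply: fin_bigcap_measurable => // j _; have [mr mi] := mf j.
    have m1 (h : X -> R) (c e : R) : measurable_fun setT h ->
        measurable [set x | `|h x - c| < e].
      move=> mh; rewrite -[X in measurable X]setTI.
      rewrite (_ : [set x | _] = h @^-1` `]c - e, c + e[%classic).
        by apply: mh => //; exact: measurable_itv.
      by apply/seteqP; split => x /=; rewrite in_itv /= ltr_distl.
    by apply: measurableI; exact: m1.
  by apply/seteqP; split => x /= h j; [move=> _; exact: h|exact: h].
apply/seteqP; split => [x /= Vx|x [t _]]; rewrite /F.
  have [t tx tV] := rat_box_basis oV Vx.
  by exists t => //; rewrite asboolT.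
by case: ifPn => // /asboolP tV /tV.
Qed.

End torus_measurable.

(** * Homomorphisms of tori and Haar measure *)

Section torus_hom_theory.
Variable R : realType.

Lemma torus_hom_comp n m p (A : 'M[int]_(n, m)) (B : 'M[int]_(m, p))
    (z : torus R p) :
  torus_hom A (torus_hom B z) = torus_hom (A *m B) z.
Proof.
apply: val_inj; apply/rowP => i; rewrite !mxE.
under eq_bigr do rewrite mxE
  (big_morph _ (fun x y => expfzMl x y (A i _)) (exp1rz _ (A i _))).
rewrite exchange_big; apply: eq_bigr => k _ /=; rewrite mxE.
have zk0 : val z ord0 k != 0 by rewrite -normr_eq0 torus_coord_norm oner_neq0.
rewrite (big_morph _ (fun a b => expfzDr a b zk0) (expr0z _)).
by apply: eq_bigr => j _; rewrite exprz_exp mulrC.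
Qed.

Lemma torus_homM n m (A : 'M[int]_(n, m)) (z w : torus R m) :
  torus_hom A (torus_mul z w) = torus_mul (torus_hom A z) (torus_hom A w).
Proof.
apply: val_inj; apply/rowP => i; rewrite !mxE -big_split /=.
by apply: eq_bigr => j _; rewrite mxE expfzMl.
Qed.

Lemma torus_mulC n (z w : torus R n) : torus_mul z w = torus_mul w z.
Proof. by apply: val_inj; apply/rowP => i; rewrite !mxE mulrC. Qed.

Lemma torus_hom_measurable n m (A : 'M[int]_(n, m)) :
  measurable_fun setT (torus_hom A : torus_borel R m -> torus_borel R n).
Proof.
apply: measurable_to_torus => k /=; under eq_fun do rewrite mxE.
apply: cmeasurable_prod => j; apply: cmeasurableXz => [x|].
  exact: torus_coord_norm.
exact: (@torus_coord_measurable R m j).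
Qed.

Lemma torus_mul_measurable n d (X : measurableType d)
    (f g : X -> torus_borel R n) :
  measurable_fun setT f -> measurable_fun setT g ->
  measurable_fun setT (fun x => torus_mul (f x) (g x) : torus_borel R n).
Proof.
move=> mf mg; apply: measurable_to_torus => k /=; under eq_fun do rewrite mxE.
by apply: cmeasurableM;
  [exact: (cmeasurable_comp mf (@torus_coord_measurable R n k))
  |exact: (cmeasurable_comp mg (@torus_coord_measurable R n k))].
Qed.

Local Open Scope ereal_scope.

(** The argument for uniqueness of Haar measure. Integrate the indicator of
    the pairs (x, z) with x * q_A(z) in U. For fixed z, invariance of tau_n
    gives tau_n U; for fixed x, writing x = q_A(w) and using invariance of
    tau_m under w gives tau_m (q_A^-1 U). By Tonelli's theorem the two constants
    agree, both measures having total mass 1. *)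
Lemma torus_hom_preserves_haar n m
    (tau_n : probability (torus_borel R n) R)
    (tau_m : probability (torus_borel R m) R) (A : 'M[int]_(n, m)) :
  normalized_haar tau_n -> normalized_haar tau_m ->
  (forall w : torus R n, exists z, torus_hom A z = w) ->
  forall U : set (torus_borel R n), measurable U ->
    tau_m (torus_hom A @^-1` U) = tau_n U.
Proof.
move=> inv_n inv_m surjA U mU.
pose q : torus_borel R m -> torus_borel R n := torus_hom A.
have mq : measurable_fun setT q by exact: torus_hom_measurable.
have mqU : measurable (q @^-1` U).
  by rewrite -[X in measurable X]setTI; exact: mq.
pose S : set (torus_borel R n * torus_borel R m) :=
  [set p | U (torus_mul p.1 (q p.2))].
have mmul : measurable_fun setT (fun p : torus_borel R n * torus_borel R m =>
    torus_mul p.1 (q p.2) : torus_borel R n).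
  apply: torus_mul_measurable; first exact: measurable_fst.
  exact: (measurableT_comp mq measurable_snd).
have mS : measurable S by rewrite -[X in measurable X]setTI; exact: mmul.
have mf : measurable_fun setT (fun p => (\1_S p)%:E : \bar R).
  exact/measurable_EFinP/measurable_indic.
have mulS k (a : torus R k) (V : set (torus_borel R k)) : measurable V ->
    measurable (torus_mul a @^-1` V : set (torus_borel R k)).
  move=> mV; rewrite -[X in measurable X]setTI.
  have mula : measurable_fun setT
      (fun z : torus_borel R k => torus_mul a z : torus_borel R k).
    by apply: torus_mul_measurable;
      [exact: measurable_cst|exact: measurable_id].
  exact: mula.
have intx x : \int[tau_m]_z (\1_S (x, z))%:E = tau_m (q @^-1` U).
  have [w qw] := surjA x.
  rewrite -(inv_m w _ mqU) -[X in tau_m X]setIT -integral_indic//;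
    last exact: mulS.
  apply: eq_integral => z _; rewrite !indicE; congr ((nat_of_bool _)%:R%:E).
  by apply/idP/idP; rewrite !inE /S /= /q torus_homM qw.
have intz z : \int[tau_n]_x (\1_S (x, z))%:E = tau_n U.
  rewrite -(inv_n (q z) _ mU) -[X in tau_n X]setIT -integral_indic//;
    last exact: mulS.
  apply: eq_integral => x _; rewrite !indicE; congr ((nat_of_bool _)%:R%:E).
  by apply/idP/idP; rewrite !inE /S /= torus_mulC.
have f0 p : 0 <= (\1_S p : R)%:E by rewrite lee_fin.
have := fubini_tonelli (m1 := tau_n) (m2 := tau_m) _ mf f0.
under eq_integral do rewrite intx.
under [in X in _ = X -> _]eq_integral do rewrite intz.
rewrite !integral_cst//.
rewrite [X in _ * X = _](probability_setT tau_n).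
by rewrite [X in _ = _ * X -> _](probability_setT tau_m) !mule1.
Qed.

End torus_hom_theory.

(** * Integrals of partially defined functions *)

Section L1_theory.
Variable R : realType.

Lemma ae_eq_Rintegral d (X : measurableType d) (mu : {measure set X -> \bar R})
    (f g : X -> R) : measurable_fun setT f -> measurable_fun setT g ->
  {ae mu, forall x, f x = g x} -> \int[mu]_x f x = \int[mu]_x g x.
Proof.
move=> mf mg fg; rewrite /Rintegral; congr fine; apply: ae_eq_integral => //.
- exact/measurable_EFinP.
- exact/measurable_EFinP.
- by apply: filterS fg => x fgx _ /=; rewrite fgx.
Qed.

Lemma torus_integralE n (tau : probability (torus_borel R n) R) g h :
  L1_rep tau g h ->
  torus_integral tau g =
    (\int[tau]_z complex.Re (h z)) +i* (\int[tau]_z complex.Im (h z)).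
Proof.
move=> gh; rewrite /torus_integral; case: xgetP => [k _ gk|]; last first.
  by move=> /(_ h).
have [rh mh aeh] := gh; have [rk mk aek] := gk.
have aeF : Filter (nbhs (almost_everywhere tau)) := ae_filter_ringOfSetsType tau.
have kh : {ae tau, forall z, k z = h z}.
  by apply: filterS2 aeh aek => z -> [->].
have mE (f : torus_borel R n -> R) :
    tau.-integrable setT (EFin \o f) -> measurable_fun setT f.
  by move=> /measurable_int/measurable_EFinP.
congr Complex; apply: ae_eq_Rintegral; try exact: mE;
  by apply: filterS kh => z ->.
Qed.

Local Open Scope ereal_scope.

Lemma measure_preserving_integral d d' (X : measurableType d)
    (Y : measurableType d') (mu : {measure set X -> \bar R})
    (nu : {measure set Y -> \bar R}) (q : X -> Y) (f : Y -> \bar R) :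
  measurable_fun setT q ->
  (forall U, measurable U -> mu (q @^-1` U) = nu U) ->
  nu.-integrable setT f ->
  mu.-integrable setT (f \o q) /\ \int[mu]_x f (q x) = \int[nu]_y f y.
Proof.
move=> mq qU intf; have [mf foo] := integrableP _ _ _ intf.
have pushE (g : Y -> \bar R) :
    \int[pushforward mu q]_y g y = \int[nu]_y g y.
  by apply: eq_measure_integral => U mU _; rewrite -qU.
have intfq : mu.-integrable setT (f \o q).
  apply/integrableP; split; first exact: measurableT_comp.
  move: foo; rewrite -pushE ge0_integral_pushforward//.
  exact: measurableT_comp.
by split=> //; rewrite -pushE integral_pushforward.
Qed.

Local Close Scope ereal_scope.

(** Composing with q_A is a measure-preserving change of variables; the
    exceptional null set of a representative pulls back to a null set. *)
Lemma torus_integral_comp_onto n m (tau_n : probability (torus_borel R n) R)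
    (tau_m : probability (torus_borel R m) R) (A : 'M[int]_(n, m))
    (g : pfun R n) :
  normalized_haar tau_n -> normalized_haar tau_m ->
  (forall w : torus R n, exists z, torus_hom A z = w) ->
  in_L1 tau_n g ->
  in_L1 tau_m (g \o torus_hom A) /\
  torus_integral tau_m (g \o torus_hom A) = torus_integral tau_n g.
Proof.
move=> inv_n inv_m surjA [h gh].
have qU := torus_hom_preserves_haar inv_n inv_m surjA.
have mq := @torus_hom_measurable R n m A.
have [rh ih aeh] := gh.
have [rhq rE] := measure_preserving_integral mq qU rh.
have [ihq iE] := measure_preserving_integral mq qU ih.
have ghq : L1_rep tau_m (g \o torus_hom A) (h \o torus_hom A).
  split=> //; have [N [mN N0 sN]] := aeh.
  exists (torus_hom A @^-1` N); split.
  - by rewrite -[X in measurable X]setTI; exact: mq.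
  - by rewrite qU.
  - by move=> z /= hz; exact: sN.
split; first by exists (h \o torus_hom A).
rewrite (torus_integralE ghq) (torus_integralE gh).
by rewrite /Rintegral rE iE.
Qed.

End L1_theory.

(** * Boyd heights *)

Section boyd_height_theory.
Variable R : realType.

Lemma boyd_height_geP n m (A : 'M[int]_(n, m)) (M : R) :
  (M%:E <= boyd_height R A)%E <->
  forall v : 'rV[int]_n, v != 0 -> v *m A = 0 -> M <= (sup_norm v)%:R.
Proof.
split=> [MA v v0 vA|MA].
  by rewrite -lee_fin; apply: (le_trans MA); apply: ereal_inf_lbound; exists v.
by apply: le_ereal_inf_tmp => _ [v [v0 vA] <-]; rewrite lee_fin; exact: MA.
Qed.

Lemma sup_norm_ge n (v : 'rV[int]_n) j : (`|v ord0 j| <= sup_norm v)%N.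
Proof. exact: (@leq_bigmax _ (fun j => `|v ord0 j|%N)). Qed.

(** The column (1, K, K^2, ...) has height at least K > 0: if a nonzero v is
    orthogonal to it, then K divides the first nonzero entry of v. *)
Lemma exists_high_column m (N : nat) :
  exists s : 'cV[int]_m, (N%:R%:E <= boyd_height R s)%E.
Proof.
(* The successor keeps K nonzero when N = 0. *)
pose K : int := N.+1.
exists (\col_j K ^+ j); apply/boyd_height_geP => v v0 vs.
have [j0 vj0] : exists j, v ord0 j != 0.
  apply/existsP; apply: contraNT v0; rewrite negb_exists => /forallP v0.
  by apply/eqP/rowP => j; rewrite mxE; apply/eqP; move: (v0 j); rewrite negbK.
case: (@arg_minnP _ j0 (fun j => v ord0 j != 0) (@nat_of_ord m) vj0)
  => j vj jmin.
have : (v *m \col_j K ^+ j) ord0 ord0 = 0 by rewrite vs mxE.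
rewrite mxE (bigD1 j)//= mxE => /eqP; rewrite addr_eq0 => /eqP vjE.
have Kdvd : (K ^+ j.+1 %| v ord0 j * K ^+ j)%Z.
  rewrite vjE rpredN; apply: rpred_sum => i ij; rewrite mxE.
  have [/jmin ji|/negPn/eqP ->] := boolP (v ord0 i != 0); last first.
    by rewrite mul0r dvdz0.
  by rewrite dvdz_mull// dvdz_exp2l// ltn_neqAle ji andbT eq_sym; exact: ij.
rewrite ler_nat; apply: leq_trans (sup_norm_ge v j); apply: ltnW.
move: Kdvd; rewrite exprS dvdz_mul2r ?expf_neq0// => /dvdn_leq; apply.
by rewrite absz_gt0.
Qed.

(** If v A B = 0 with v nonzero and small, then v A is nonzero because A has
    height at least M, and its norm is bounded in terms of A alone; this cannot
    happen once the height of B exceeds that bound. *)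
Lemma boyd_height_mulmx n m (A : 'M[int]_(n, m)) (M : R) :
  (M%:E <= boyd_height R A)%E ->
  exists N : nat, forall p (B : 'M[int]_(m, p)),
    (N%:R%:E <= boyd_height R B)%E -> (M%:E <= boyd_height R (A *m B))%E.
Proof.
move=> /boyd_height_geP MA.
pose S := (\sum_i \sum_j absz (A i j))%N; pose K := Num.bound `|M|.
exists (K * S).+1 => p B /boyd_height_geP NB.
apply/boyd_height_geP => v v0 vAB; rewrite leNgt; apply/negP => vM.
have vK : (sup_norm v < K)%N.
  rewrite -(ltr_nat R); apply: (lt_le_trans vM).
  exact: le_trans (ler_norm _) (ltW (archi_boundP (normr_ge0 M))).
have vA0 : v *m A != 0.
  by apply/eqP => vA; move: (MA v v0 vA); rewrite leNgt vM.
have := NB _ vA0; rewrite -mulmxA => /(_ vAB).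
rewrite ler_nat ltnNge => /negP; apply.
apply/bigmax_leqP => j _; rewrite mxE.
have lesum (I : finType) (F : I -> int) :
    (absz (\sum_i F i)%R <= \sum_i absz (F i))%N.
  elim/big_ind2: _ => // x a y b ha hb.
  lia.
apply: (leq_trans (lesum _ _)); rewrite /S big_distrr /=; apply: leq_sum => i _.
rewrite abszM leq_mul//; first exact: leq_trans (sup_norm_ge v i) (ltnW vK).
by rewrite (bigD1 j)//= leq_addr.
Qed.

Lemma unit_circle_root (z : R[i]) (a : int) : `|z| = 1 -> a != 0 ->
  exists2 w : R[i], `|w| = 1 & w ^ a = z.
Proof.
have pos (k : nat) (y : R[i]) : (0 < k)%N -> `|y| = 1 ->
    exists2 w : R[i], `|w| = 1 & w ^+ k = y.
  move=> k0 y1; exists (k.-root y); last exact: rootCK.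
  by apply/eqP; rewrite -(@pexpr_eq1 _ _ k)// -normrX rootCK// y1.
case: a => k z1 a0.
  by apply: pos; rewrite // lt0n.
(* A negative exponent is absorbed by taking a root of z^-1. *)
have [|w w1 wk] := pos k.+1 z^-1 isT; first by rewrite normfV z1 invr1.
by exists w => //; rewrite NegzE -exprnN wk invrK.
Qed.

(** Take a root in a coordinate with nonzero exponent and 1 in the others. *)
Lemma torus_hom_row_onto m (A : 'rV[int]_m) : A != 0 ->
  forall w : torus R 1, exists z : torus R m, torus_hom A z = w.
Proof.
move=> A0 w.
have [j Aj] : exists j, A ord0 j != 0.
  apply/existsP; apply: contraNT A0; rewrite negb_exists => /forallP A0.
  by apply/eqP/rowP => j; rewrite mxE; apply/eqP; move: (A0 j); rewrite negbK.
have [y y1 yw] := unit_circle_root (torus_coord_norm w ord0) Aj.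
pose z : 'rV[R[i]]_m := \row_k (if k == j then y else 1).
have zP : [forall k, `|z ord0 k| == 1].
  by apply/forallP => k; rewrite mxE; case: (k == j); rewrite ?y1 ?normr1 eqxx.
exists (exist (fun z : 'rV_m => [forall k, `|z ord0 k| == 1]) z zP).
apply: val_inj; apply/rowP => i; rewrite (ord1 i) /= mxE.
rewrite (bigD1 j)//= mxE eqxx yw big1 ?mulr1// => k /negPf kj.
by rewrite mxE kj exp1rz.
Qed.

(** The zero row is annihilated by v = 1, so its height is 1. *)
Lemma boyd_height_row_neq0 m (A : 'rV[int]_m) :
  (2%:E <= boyd_height R A)%E -> A != 0.
Proof.
move=> /boyd_height_geP hA; apply/eqP => A0.
have := hA 1; rewrite oner_neq0 A0 mulmx0 => /(_ isT erefl).
by rewrite /sup_norm big_ord1 mxE eqxx /= (ler_nat R 2 1).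
Qed.

End boyd_height_theory.

(** * The limit over matrices *)

Section boyd_lawton_limit.
Variables (R : realType) (tau : forall n, probability (torus_borel R n) R).
Variable C : forall n, set (pfun R n).
Hypothesis BL_C : boyd_lawton tau C.

(** For m > 1 both integrals are compared with the integral over the circle of
    g o q_(A s), where s is a column of very large height: it approximates the
    integral of g o q_A by the limit property of that function, and the
    integral of g because A s still has height at least M. For m = 1 the matrix
    A is itself a column. *)
Lemma boyd_lawton_lim_matrix n (g : pfun R n) : (1 < n)%N -> C g ->
  forall e : R, 0 < e -> exists M : R, forall m (A : 'M[int]_(n, m)),
    (0 < m)%N -> (M%:E <= boyd_height R A)%E ->
    `|torus_integral (tau n) g - torus_integral (tau m) (g \o torus_hom A)|
      < e%:C.
Proof.
move=> n1 Cg e e0; have e20 : 0 < e / 2 by rewrite divr_gt0.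
have [M gM] := boyd_lawton_lim BL_C n1 Cg e20.
have [B gB] := boyd_lawton_comp BL_C (ltnW n1) Cg.
exists (Num.max M B) => m A m0 hA.
have MA : (M%:E <= boyd_height R A)%E.
  by apply: le_trans hA; rewrite lee_fin le_max lexx.
have BA : (B%:E <= boyd_height R A)%E.
  by apply: le_trans hA; rewrite lee_fin le_max lexx orbT.
have [m1|m1] := ltnP 1 m; last first.
  have {m0}m1 : m = 1%N by apply/eqP; rewrite eqn_leq m1.
  subst m; have [_ /lt_le_trans] := gM A MA; apply.
  by rewrite lecR; lra.
have [M' gAM'] := boyd_lawton_lim BL_C m1 (gB m A m0 BA) e20.
have [N AN] := boyd_height_mulmx MA.
have [s sN] := exists_high_column R m (maxn N (Num.bound `|M'|)).
have M's : (M'%:E <= boyd_height R s)%E.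
  apply: le_trans sN; rewrite lee_fin (le_trans (ler_norm _))//.
  rewrite (le_trans (ltW (archi_boundP (normr_ge0 M'))))//.
  by rewrite ler_nat leq_maxr.
have Ns : (N%:R%:E <= boyd_height R s)%E.
  by apply: le_trans sN; rewrite lee_fin ler_nat leq_maxl.
have [_ gAs] := gM (A *m s) (AN _ _ Ns).
have [_] := gAM' s M's.
have -> : (g \o torus_hom A) \o torus_hom s = g \o torus_hom (A *m s).
  by apply/funext => z /=; rewrite torus_hom_comp.
rewrite distrC => gA.
rewrite (splitr e) rmorphD /=.
exact: le_lt_trans (ler_distD _ _ _) (ltrD gAs gA).
Qed.

End boyd_lawton_limit.

Theorem corollary1p4 (R : realType)
    (tau : forall n : nat, probability (torus_borel R n) R)
    (haar_tau : forall n : nat, normalized_haar (tau n))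
    (C : forall n : nat, set (pfun R n)) (BL_C : boyd_lawton tau C)
    (n : nat) (n_gt0 : (0 < n)%N) (g : pfun R n) (Cg : C n g)
    (m : nat -> nat) (m_gt0 : forall i : nat, (0 < m i)%N)
    (A : forall i : nat, 'M[int]_(n, m i))
    (height_A : forall M : R,
      \forall i \near \oo, (M%:E <= boyd_height R (A i))%E) :
  (\forall i \near \oo, in_L1 (tau (m i)) (g \o torus_hom (A i))) /\
  (torus_integral (tau (m i)) (g \o torus_hom (A i)) : R[i]^o) @[i --> \oo] -->
    (torus_integral (tau n) g : R[i]^o).
Proof.
split.
  have [B gB] := boyd_lawton_comp BL_C n_gt0 Cg.
  apply: filterS (height_A B) => i BA.
  exact: (boyd_lawton_L1 BL_C (m_gt0 i) (gB _ _ (m_gt0 i) BA)).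
apply/cvgrPdist_lt => e e_gt0.
(* For complex e the relation 0 < e means that e is real and positive. *)
have -> : e = (complex.Re e)%:C by rewrite RRe_real ?gtr0_real.
have {e_gt0} : 0 < complex.Re e by move: e_gt0; rewrite ltcE => /andP[].
move: (complex.Re e) => {}e e_gt0.
have [n1|n1] := ltnP 1 n.
  have [M gM] := boyd_lawton_lim_matrix BL_C n1 Cg e_gt0.
  by apply: filterS (height_A M) => i; exact: gM.
have {n_gt0}n1 : n = 1%N by apply/eqP; rewrite eqn_leq n1.
subst n.
(* The limit property says nothing about the circle itself: there the integrals
   are equal as soon as q_(A i) is onto. *)
apply: filterS (height_A 2) => i /boyd_height_row_neq0 A0.
have gL1 := boyd_lawton_L1 BL_C (ltnSn 0) Cg.
have [_ ->] := torus_integral_comp_onto (haar_tau 1) (haar_tau (m i))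
  (torus_hom_row_onto A0) gL1.
by rewrite subrr normr0 ltcR.
Qed.
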